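(* For any looped graph $G$ on $n\ge2$ vertices, \[\lambda_1(G)+\lambda_2(\overline{G})\le\frac87 n.\]
   Context: A looped graph on $n$ vertices is an undirected graph without multiple edges in which each vertex may carry at most one loop; its adjacency matrix $A(G)$ is the symmetric $n\times n$ $\{0,1\}$-matrix with $(u,v)$ entry $1$ iff $uv$ is an edge (a loop gives diagonal entry $1$). The complement $\overline{G}$ is the looped graph with $A(G)+A(\overline{G})=J_n$, the all-ones matrix. Eigenvalues of $A(G)$ are ordered $\lambda_1(G)\ge\cdots\ge\lambda_n(G)$. *)

(* Defs.v *)
From mathcomp Require Import all_boot all_order all_algebra.
From mathcomp Require Import spectral sesquilinear.
From mathcomp Require Import complex polyrcf.

Set Implicit Arguments.
Unset Strict Implicit.
Unset Printing Implicit Defensive.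

Import Order.TTheory GRing.Theory Num.Theory.
Local Open Scope ring_scope.

(* No irreflexivity is required: [edge G i i] says that [i] carries a loop.   *)
Record looped_graph (n : nat) := LoopedGraph {
  edge : rel 'I_n;
  edge_sym : symmetric edge
}.

(* Loops are complemented too: [i] has a loop in exactly one of [G] and its   *)
(* complement.                                                                *)
Definition graph_compl n (G : looped_graph n) : looped_graph n :=
  @LoopedGraph n (fun i j => ~~ edge G i j)
    (fun i j => congr1 negb (edge_sym G i j)).

Definition adjmx (R : nzRingType) n (G : looped_graph n) : 'M[R]_n :=
  \matrix_(i, j) (edge G i j)%:R.

Lemma adjmx_compl (R : nzRingType) n (G : looped_graph n) :
  adjmx R G + adjmx R (graph_compl G) = const_mx 1.
Proof.
by apply/matrixP=> i j; rewrite !mxE /=; case: edge; rewrite ?addr0 ?add0r.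
Qed.

Lemma adjmx_sym (R : nzRingType) n (G : looped_graph n) :
  (adjmx R G)^T = adjmx R G.
Proof. by apply/matrixP=> i j; rewrite !mxE edge_sym. Qed.

(* The real eigenvalues in nonincreasing order, each repeated according to    *)
(* its algebraic multiplicity; for a symmetric matrix these are all the       *)
(* eigenvalues, by [char_poly_eigvals].                                       *)
Definition eigvals (R : rcfType) n (A : 'M[R]_n) : seq R :=
  sort >=%R
    (flatten [seq nseq (mup x (char_poly A)) x | x <- rootsR (char_poly A)]).

(* The index [k] starts at 1; the value is 0 when [k] exceeds the length.      *)
Definition lambda (R : rcfType) (k : nat) n (A : 'M[R]_n) : R :=
  (eigvals A)`_k.-1.

Lemma count_eigvals (R : rcfType) n (A : 'M[R]_n) x :
  count_mem x (eigvals A) = mup x (char_poly A).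
Proof.
set p := char_poly A; have p0 : p != 0 by rewrite monic_neq0 ?char_poly_monic.
have /permP -> : perm_eq (eigvals A)
    (flatten [seq nseq (mup x (char_poly A)) x | x <- rootsR (char_poly A)]).
  by rewrite /eigvals perm_sort.
rewrite count_flatten -map_comp -/p.
have U : uniq (rootsR p) by rewrite uniq_roots.
have M : (x \in rootsR p) = root p x.
  by rewrite -roots_on_rootsR //= in_itv.
rewrite sumnE big_map.
under eq_bigr => y _ do rewrite /= count_nseq /=.
rewrite (eq_bigr (fun y => if y == x then mup x p else 0)%N); last first.
  by move=> y _; case: eqP => [->|_]; rewrite ?mul1n ?mul0n.
rewrite -big_mkcond big_const_seq iter_addn_0 count_uniq_mem // M.
by case: (boolP (root p x)) => [_|/mupNroot ->]; rewrite ?muln1 ?mul0n.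
Qed.

Lemma char_poly_eigvals (R : rcfType) n (A : 'M[R]_n) : A^T = A ->
  char_poly A = \prod_(x <- eigvals A) ('X - x%:P).
Proof.
move=> As.
suff [s Es] : exists s : seq R, char_poly A = \prod_(x <- s) ('X - x%:P).
  rewrite Es; apply: perm_big; apply/allP => x _ /=; apply/eqP.
  by rewrite count_eigvals Es mu_prod_XsubC.
pose B : 'M[R[i]]_n := map_mx (real_complex R) A.
have Br : B \is a mxOver Num.real.
  by apply/mxOverP=> i j; rewrite mxE complex_real.
have Bh : B \is hermsymmx.
  apply: realsym_hermsym => //; apply/is_hermitianmxP.
  by rewrite expr0 scale1r map_mx_id // /B map_trmx As.
have /orthomx_spectralP := hermitian_normalmx Bh.
have /mxOverP := hermitian_spectral_diag_real Bh.
set D := spectral_diag B; set P := spectralmx B => Dr BE.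
exists [seq complex.Re (D 0 i) | i <- enum 'I_n].
apply: (@map_poly_inj _ _ (real_complex R)).
rewrite map_char_poly -/B rmorph_prod big_map big_enum /=.
transitivity (char_poly (diag_mx D)).
  have Pu : P \in unitmx by exact: spectral_unit.
  pose Q := map_mx polyC P.
  have VQ : map_mx polyC (invmx P) *m Q = 1%:M.
    by rewrite -map_mxM mulVmx // map_mx1.
  rewrite /char_poly BE.
  have -> : char_poly_mx (invmx P *m diag_mx D *m P) =
      map_mx polyC (invmx P) *m char_poly_mx (diag_mx D) *m Q.
    rewrite /char_poly_mx mulmxBr mulmxBl !map_mxM scalar_mxC.
    by rewrite -(mulmxA (_%:M)) VQ mulmx1.
  by rewrite !det_mulmx mulrAC -det_mulmx VQ det1 mul1r.
rewrite char_poly_trig ?diag_mx_is_trig //; apply: eq_bigr => i _.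
rewrite mxE eqxx mulr1n rmorphB /= map_polyX map_polyC /=.
by have := Dr 0 i; case: (D 0 i) => a b /complex_realP [c [-> ->]].
Qed.

Lemma size_eigvals (R : rcfType) n (A : 'M[R]_n) : A^T = A ->
  size (eigvals A) = n.
Proof.
move=> /char_poly_eigvals /(congr1 (fun p : {poly R} => size p)).
by rewrite size_char_poly size_prod_XsubC => -[].
Qed.

(* Main.v *)
(** Let A, B be the adjacency matrices of the graph and of its complement, x
    and y the eigenvalues considered. The modulus f of an eigenvector of A
    satisfies f A >= x f. Two orthogonal eigenvectors of B for eigenvalues >= y
    either have a member with both signs, and then its positive and negative
    parts, or else their moduli, give disjointly supported p, q >= 0 with
    p B >= y p and q B >= y q (if y is also the largest eigenvalue of B, take
    an eigenvector of sum 0). With S = sum f and T = sum p, computing f J p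
    with J = A + B gives (x + y) <f, p> <= S T. The vectors S - x f >= f B and
    T - y p >= p A are nonnegative, so <S - x f, T - y p> is at least
    T times the sum of S - x f outside the support of p. Adding this
    inequality to its analogue for q yields
    x^2 + x y + 2 y^2 <= n (x + y), hence 7 (x + y) <= 8 n since
    8 (x^2 + x y + 2 y^2) - 7 (x + y)^2 = (x - 3 y)^2. *)

Require Import Defs.
From mathcomp Require Import all_boot all_order all_algebra.
From mathcomp Require Import reals.
From mathcomp Require Import spectral sesquilinear complex polyrcf ring lra.

Set Implicit Arguments.
Unset Strict Implicit.
Unset Printing Implicit Defensive.

Import Order.TTheory GRing.Theory Num.Theory.
Local Open Scope ring_scope.

(** * Inequalities for sub-eigenvectors of two complementary nonnegative matrices *)

Section Bounds.
Variables (R : realFieldType) (n : nat).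
Implicit Types (A B : 'M[R]_n) (f p : 'I_n -> R) (x y : R).

(** Only an inequality is asked, so that moduli and positive parts of eigenvectors of a nonnegative
    matrix qualify and [x] may be lowered. *)
Definition subeigen A x f : Prop :=
  [/\ forall i, 0 <= f i, exists i, f i != 0 &
      forall j, x * f j <= \sum_i f i * A i j].

Lemma subeigen_sum_gt0 A x f : subeigen A x f -> 0 < \sum_i f i.
Proof.
move=> [f0 [i fi] _]; rewrite (bigD1 i) //=.
apply: ltr_wpDr; first exact: sumr_ge0.
by rewrite lt_def fi f0.
Qed.

Lemma subeigen_le_sum A x f j : (forall i j, A i j <= 1) ->
  subeigen A x f -> x * f j <= \sum_i f i.
Proof.
move=> A1 [f0 _ /(_ j) xf]; apply: le_trans xf _.
by apply: ler_sum => i _; rewrite ler_piMr.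
Qed.

Lemma subeigen_le_size A x f : (forall i j, A i j <= 1) ->
  subeigen A x f -> x <= n%:R.
Proof.
move=> A1 fP; have S0 := subeigen_sum_gt0 fP.
rewrite -(ler_pM2r S0) mulr_sumr.
apply: (@le_trans _ _ (\sum_(j < n) \sum_i f i)).
  by apply: ler_sum => j _; apply: subeigen_le_sum fP.
by rewrite sumr_const card_ord mulr_natl.
Qed.

Variables (A B : 'M[R]_n).
Hypotheses (A_ge0 : forall i j, 0 <= A i j) (B_ge0 : forall i j, 0 <= B i j).
Hypotheses (B_sym : B^T = B) (AB1 : A + B = const_mx 1).

Let ABE i j : A i j + B i j = 1.
Proof. by move/matrixP/(_ i j): AB1; rewrite !mxE. Qed.

Lemma subeigen_dot f p x y : subeigen A x f -> subeigen B y p ->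
  (x + y) * \sum_i f i * p i <= (\sum_i f i) * (\sum_i p i).
Proof.
move=> [f0 _ xf] [p0 _ yp].
have -> : (\sum_i f i) * (\sum_i p i) =
    \sum_j p j * (\sum_i f i * A i j) + \sum_j f j * (\sum_i p i * B i j).
  rewrite mulrC mulr_suml.
  under [X in _ = _ + X]eq_bigr do rewrite mulr_sumr.
  rewrite [X in _ = _ + X]exchange_big -big_split /=; apply: eq_bigr => j _.
  rewrite !mulr_sumr -big_split /=; apply: eq_bigr => i _.
  by rewrite -[in B j i]B_sym mxE -[LHS]mulr1 -(ABE i j); ring.
rewrite mulrDl !mulr_sumr; apply: lerD; apply: ler_sum => j _.
  by rewrite mulrA mulrC ler_wpM2l.
by rewrite mulrCA ler_wpM2l.
Qed.

(** Expanding the sum of [(S - x * f j) * (T - y * p j)] gives [(n - x - y) * S * T] plus [x * y]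
    times the inner product of [f] and [p], which [subeigen_dot] bounds by [S * T / (x + y)]. *)
Lemma subeigen_off_support f p x y : 0 < x -> 0 < y ->
  subeigen A x f -> subeigen B y p ->
  \sum_(j | p j == 0) (\sum_i f i - x * f j)
    <= (n%:R - (x + y) + x * y / (x + y)) * \sum_i f i.
Proof.
move=> x0 y0 fP pP.
have A_le1 i j : A i j <= 1 by have := ABE i j; have := B_ge0 i j; lra.
have B_le1 i j : B i j <= 1 by have := ABE i j; have := A_ge0 i j; lra.
have := subeigen_sum_gt0 fP; have := subeigen_sum_gt0 pP.
have := subeigen_dot fP pP.
have fS j : x * f j <= \sum_i f i by apply: subeigen_le_sum fP.
have pT j : y * p j <= \sum_i p i by apply: subeigen_le_sum pP.
move: fS pT; set S := \sum_i f i; set T := \sum_i p i => fS pT dot T0 S0.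
rewrite -(ler_pM2l T0).
apply: (@le_trans _ _ (\sum_j (S - x * f j) * (T - y * p j))).
  rewrite mulr_sumr big_mkcond /=; apply: ler_sum => j _.
  have [->|_] := eqVneq; first by rewrite mulr0 subr0 mulrC.
  by rewrite mulr_ge0 ?subr_ge0.
have -> : \sum_j (S - x * f j) * (T - y * p j) =
    (n%:R - (x + y)) * (S * T) + x * y * \sum_i f i * p i.
  transitivity (\sum_(j < n) (S * T - (S * y) * p j - (T * x) * f j +
                  x * y * (f j * p j))); first by apply: eq_bigr => j _; ring.
  rewrite !big_split /= !sumrN -!mulr_sumr sumr_const card_ord -/S -/T.
  by rewrite -mulr_natl; ring.
have -> : T * ((n%:R - (x + y) + x * y / (x + y)) * S) =
    (n%:R - (x + y)) * (S * T) + x * y * (S * T / (x + y)) by ring.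
rewrite lerD2l ler_pM2l ?mulr_gt0 //.
by rewrite ler_pdivlMr ?addr_gt0 // mulrC.
Qed.

Lemma subeigen_sum_le f p q x y :
  subeigen A x f -> subeigen B y p -> subeigen B y q ->
  (forall i, p i * q i = 0) -> x + y <= 8%:R / 7%:R * n%:R.
Proof.
move=> fP pP qP pq0.
have A_le1 i j : A i j <= 1 by have := ABE i j; have := B_ge0 i j; lra.
have B_le1 i j : B i j <= 1 by have := ABE i j; have := A_ge0 i j; lra.
have xn := subeigen_le_size A_le1 fP.
have yn := subeigen_le_size B_le1 pP.
have n0 : 0 <= n%:R :> R by [].
(* If one of [x], [y] is not positive, the other one is at most [n], hence so is the sum. *)
have [x0|x0] := leP x 0; first lra.
have [y0|y0] := leP y 0; first lra.
have hp := subeigen_off_support x0 y0 fP pP.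
have hq := subeigen_off_support x0 y0 fP qP.
have fS j : x * f j <= \sum_i f i by apply: subeigen_le_sum fP.
have S0 := subeigen_sum_gt0 fP.
(* Each index lies outside the support of [p] or of [q], so the two off-support sums together
   dominate the full sum, which is [n - x] times the sum of [f]. *)
have : n%:R - x <= 2 * (n%:R - (x + y) + x * y / (x + y)).
  rewrite -(ler_pM2r S0).
  rewrite mulr_natl mulr2n [leRHS]mulrDl; apply: le_trans _ (lerD hp hq).
  rewrite [X in _ <= X + _]big_mkcond [X in _ <= _ + X]big_mkcond -big_split /=.
  have -> : (n%:R - x) * \sum_i f i = \sum_(j < n) (\sum_i f i - x * f j).
    by rewrite big_split /= sumr_const card_ord sumrN -mulr_sumr -mulr_natl; ring.
  apply: ler_sum => j _; have fj := fS j.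
  move/eqP: (pq0 j); rewrite mulf_eq0; case: (p j == 0) => /= [_|->].
    by rewrite lerDl; case: ifP; rewrite ?subr_ge0.
  by rewrite add0r.
have xy0 : 0 < x + y by lra.
have : x * y / (x + y) * (x + y) = x * y by rewrite divfK ?gt_eqF.
set w := x * y / (x + y) => hw /(ler_wpM2r (ltW xy0)) h.
by rewrite -(ler_pM2r xy0); have := sqr_ge0 (x - 3 * y); nra.
Qed.

End Bounds.

(** * Diagonalization over [R[i]] and multiple eigenvalues *)

Lemma sym_complex_spectral (R : rcfType) n (A : 'M[R]_n) : A^T = A ->
  exists (P : 'M[R[i]]_n) (D : 'rV[R[i]]_n), P \in unitmx /\
    map_mx (real_complex R) A = invmx P *m diag_mx D *m P.
Proof.
move=> As; set B := map_mx _ A.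
have Bh : B \is hermsymmx.
  apply: realsym_hermsym; last by apply/mxOverP=> i j; rewrite mxE complex_real.
  by apply/is_hermitianmxP; rewrite expr0 scale1r map_mx_id // /B map_trmx As.
exists (spectralmx B), (spectral_diag B); split; first exact: spectral_unit.
exact/orthomx_spectralP/hermitian_normalmx.
Qed.

Lemma char_poly_similar_diag (F : fieldType) n (P : 'M[F]_n) (D : 'rV[F]_n) :
  P \in unitmx ->
  char_poly (invmx P *m diag_mx D *m P) = \prod_i ('X - (D 0 i)%:P).
Proof.
move=> Pu; transitivity (char_poly (diag_mx D)).
  have VQ : map_mx polyC (invmx P) *m map_mx polyC P = 1%:M.
    by rewrite -map_mxM mulVmx // map_mx1.
  rewrite /char_poly.
  have -> : char_poly_mx (invmx P *m diag_mx D *m P) =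
      map_mx polyC (invmx P) *m char_poly_mx (diag_mx D) *m map_mx polyC P.
    rewrite /char_poly_mx mulmxBr mulmxBl !map_mxM scalar_mxC.
    by rewrite -(mulmxA (_%:M)) VQ mulmx1.
  by rewrite !det_mulmx mulrAC -det_mulmx VQ det1 mul1r.
rewrite char_poly_trig ?diag_mx_is_trig //.
by apply: eq_bigr => i _; rewrite mxE eqxx.
Qed.

(* Two coordinates of an eigenbasis over R[i] meet the linear constraint; the *)
(* kernel found there has the same dimension over R.                          *)
Lemma double_root_eigvec_sum0 (R : rcfType) n (A : 'M[R]_n) x : A^T = A ->
  (1 < mup x (char_poly A))%N ->
  exists v : 'rV[R]_n, [/\ v != 0, v *m A = x *: v & \sum_i v 0 i = 0].
Proof.
move=> As mx; have [P [D [Pu AE]]] := sym_complex_spectral As.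
pose c := real_complex R.
have : (1 < mup (c x) (\prod_i ('X - (D 0 i)%:P)))%N.
  rewrite -(char_poly_similar_diag _ Pu) -AE -map_char_poly.
  rewrite !mup_geq ?map_poly_eq0 ?monic_neq0 ?char_poly_monic // in mx *.
  have -> : 'X - (c x)%:P = map_poly c ('X - x%:P).
    by rewrite rmorphB /= map_polyX map_polyC.
  by rewrite -rmorphXn dvdp_map.
have -> : \prod_i ('X - (D 0 i)%:P) =
    \prod_(y <- [seq D 0 i | i <- enum 'I_n]) ('X - y%:P).
  by rewrite big_map -big_enum.
rewrite mu_prod_XsubC count_map -size_filter enumT.
have -> : forall a : pred 'I_n, size [seq i <- Finite.enum 'I_n | a i] = #|a|.
  by move=> a; rewrite cardE.
move=> /card_gt1P [i [j [Di Dj ij]]].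
(* The left kernel of [M] consists of the [v] with [v *m A = x *: v] and coordinate sum 0. *)
pose M := row_mx (A - x%:M) (const_mx 1 : 'cV_n).
suff : ~~ row_free M.
  rewrite -kermx_eq0 => /rowV0Pn [v /sub_kermxP vM v0]; exists v.
  move: vM; rewrite mul_mx_row -[0]row_mx0 => /eq_row_mx [vA v1].
  split=> //.
    by apply/eqP; rewrite -subr_eq0 -mul_mx_scalar -mulmxBr vA.
  move/matrixP/(_ 0 0): v1; rewrite !mxE => v1; rewrite -[RHS]v1.
  by apply: eq_bigr => k _; rewrite !mxE mulr1.
rewrite -(row_free_map c) map_row_mx map_mxB map_scalar_mx map_const_mx rmorph1.
rewrite AE; set N := row_mx _ _.
(* [s k] is the sum of row [k] of [P], and [a] is chosen so that [a *m P] has coordinate sum 0. The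
   case [s i = 0] is separate because the general combination could then vanish. *)
pose s k := (P *m (const_mx 1 : 'cV_n)) k 0.
pose a : 'rV[R[i]]_n :=
  if s i == 0 then delta_mx 0 i else s j *: delta_mx 0 i - s i *: delta_mx 0 j.
have a0 : a != 0.
  rewrite /a; case: ifPn => si; apply/eqP => /matrixP.
    by move/(_ 0 i); rewrite !mxE !eqxx; apply/eqP/oner_neq0.
  move/(_ 0 j); rewrite !mxE !eqxx eq_sym (negbTE ij) mulr0 mulr1 add0r.
  by move/eqP; rewrite oppr_eq0 (negbTE si).
have aD : a *m diag_mx D = c x *: a.
  have eD k : D 0 k = c x ->
      delta_mx 0 k *m diag_mx D = c x *: delta_mx 0 k :> 'rV_n.
    by move=> Dk; rewrite -rowE row_diag_mx Dk.
  move/eqP: Di => /eD Di; move/eqP: Dj => /eD Dj; rewrite /a.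
  case: ifP => // _; rewrite mulmxBl -!scalemxAl Di Dj scalerBr.
  by rewrite !scalerA ![c x * _]mulrC.
have a1 : a *m (P *m (const_mx 1 : 'cV_n)) = 0.
  have eS k : delta_mx 0 k *m (P *m (const_mx 1 : 'cV_n)) = (s k)%:M :> 'M_1.
    by rewrite -rowE [LHS]mx11_scalar mxE.
  rewrite /a; case: ifP => [/eqP si|_]; first by rewrite eS si raddf0.
  by rewrite mulmxBl -!scalemxAl !eS !scale_scalar_mx mulrC subrr.
(* [a *m P] is a nonzero vector in the left kernel of [N]. *)
apply/negP => Nfree; move/eqP: a0; apply.
apply/eqP; rewrite -(mulmx_free_eq0 _ (_ : row_free P)) ?row_free_unit //.
rewrite -(mulmx_free_eq0 _ Nfree) mul_mx_row -[X in row_mx _ X]mulmxA a1.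
rewrite mulmxBr 2!mulmxA mulmxK // mul_mx_scalar aD -scalemxAl subrr.
by rewrite row_mx0.
Qed.

(** The list of eigenvalues has length [n >= 2], so neither value is the default 0, and two equal
    leading entries count twice in the multiplicity. *)
Lemma lambda_sorted (R : rcfType) n (A : 'M[R]_n) : A^T = A -> (2 <= n)%N ->
  [/\ root (char_poly A) (lambda 1 A), root (char_poly A) (lambda 2 A),
      lambda 2 A <= lambda 1 A &
      lambda 1 A = lambda 2 A -> (1 < mup (lambda 2 A) (char_poly A))%N].
Proof.
move=> As n2; have := size_eigvals As; rewrite -count_eigvals /lambda.
have rt x : x \in eigvals A -> root (char_poly A) x.
  by rewrite -has_pred1 has_count count_eigvals; apply: contraTT => /mupNroot ->.
have : sorted >=%R (eigvals A) by apply: sort_sorted => x y; exact: ge_total.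
case: (eigvals A) rt => [|x [|y s]] rt /= srt sz; try by rewrite -sz in n2.
split; [exact/rt/mem_head|by apply: rt; rewrite in_cons mem_head orbT| | ].
  by case/andP: srt.
by move=> ->; rewrite eqxx.
Qed.

(** * Moduli and sign parts of eigenvectors of a nonnegative matrix *)

Section SignParts.
Variables (R : realFieldType) (n : nat) (A : 'M[R]_n).
Hypothesis A_ge0 : forall i j, 0 <= A i j.
Implicit Types (u v : 'rV[R]_n) (x y : R).

Lemma subeigenW x y f : y <= x -> subeigen A x f -> subeigen A y f.
Proof.
move=> yx [f0 fn xf]; split=> // j; apply: le_trans (xf j).
by rewrite ler_wpM2r.
Qed.

Lemma eigvecE v x j : v *m A = x *: v -> x * v 0 j = \sum_i v 0 i * A i j.
Proof. by move/matrixP/(_ 0 j); rewrite !mxE => <-. Qed.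

Lemma subeigen_norm v x : v != 0 -> v *m A = x *: v ->
  subeigen A x (fun i => `|v 0 i|).
Proof.
move=> /rV0Pn [i vi] vA; split=> [//||j]; first by exists i; rewrite normr_eq0.
apply: (@le_trans _ _ `|x * v 0 j|); first by rewrite normrM ler_wpM2r ?ler_norm.
rewrite (eigvecE _ vA); apply: le_trans (ler_norm_sum _ _ _) _.
by apply: ler_sum => k _; rewrite normrM (ger0_norm (A_ge0 _ _)).
Qed.

(** Where [v] is not positive the left side is 0; elsewhere, truncating [v] at 0 can only raise the
    sum on the right. *)
Lemma subeigen_pos_part v x i : 0 < v 0 i -> v *m A = x *: v ->
  subeigen A x (fun i => Num.max (v 0 i) 0).
Proof.
move=> vi vA; split=> [k||j]; first by rewrite le_max lexx orbT.
  by exists i; rewrite gt_eqF // lt_max vi.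
have [_|vj] := leP (v 0 j) 0.
  by rewrite mulr0 sumr_ge0 // => k _; rewrite mulr_ge0 // le_max lexx orbT.
rewrite (eigvecE _ vA); apply: ler_sum => k _.
by rewrite ler_wpM2r // le_max lexx.
Qed.

Lemma subeigen_sign_parts v x i j : 0 < v 0 i -> v 0 j < 0 -> v *m A = x *: v ->
  exists p q, [/\ subeigen A x p, subeigen A x q &
    forall k, p k * q k = 0].
Proof.
move=> vi vj vA; exists (fun k => Num.max (v 0 k) 0).
exists (fun k => Num.max ((- v) 0 k) 0); split=> [||k].
- exact: subeigen_pos_part vi vA.
- by apply: (@subeigen_pos_part _ _ j); rewrite ?mxE ?oppr_gt0 // mulNmx vA scalerN.
rewrite mxE; have [_|vk] := leP (v 0 k) 0; first by rewrite mul0r.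
by rewrite max_r ?mulr0 // oppr_le0 ltW.
Qed.

(** The constant [c] is the sign 1 or -1 of [v], in a form that can be pulled out of sums. *)
Lemma sign_cases v :
  (exists i j, 0 < v 0 i /\ v 0 j < 0) \/ exists c, forall i, `|v 0 i| = c * v 0 i.
Proof.
have [/existsP [i vi]|/existsPn npos] := boolP [exists i, 0 < v 0 i]; last first.
  by right; exists (-1) => i; rewrite mulN1r ler0_norm // leNgt.
have [/existsP [j vj]|/existsPn nneg] := boolP [exists i, v 0 i < 0].
  by left; exists i, j.
by right; exists 1 => k; rewrite mul1r ger0_norm // leNgt.
Qed.

Lemma sym_eigvec_orthogonal u v x y : A^T = A -> x != y ->
  u *m A = x *: u -> v *m A = y *: v -> \sum_i u 0 i * v 0 i = 0.
Proof.
move=> As xy uA vA; have : (x - y) *: (u *m v^T) = 0.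
  rewrite scalerBl scalemxAl -uA scalemxAr -linearZ /= -vA.
  by rewrite trmx_mul As mulmxA subrr.
move/eqP; rewrite scaler_eq0 subr_eq0 (negbTE xy) => /eqP/matrixP/(_ 0 0).
by rewrite !mxE => uv; rewrite -[RHS]uv; apply: eq_bigr => i _; rewrite mxE.
Qed.

End SignParts.

(** * Disjoint sub-eigenvectors for [lambda 2], and the final bound *)

Lemma disjoint_subeigen (R : rcfType) n (A : 'M[R]_n) : (2 <= n)%N ->
  A^T = A -> (forall i j, 0 <= A i j) ->
  exists p q, [/\ subeigen A (lambda 2 A) p, subeigen A (lambda 2 A) q &
    forall i, p i * q i = 0].
Proof.
move=> n2 As A0; have [r1 r2 le21 eq12] := lambda_sorted As n2.
have [/eq12/(double_root_eigvec_sum0 As) [v [v0 vA vs]]|ne12] :=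
    eqVneq (lambda 1 A) (lambda 2 A).
  have [[i [j [vi vj]]]|[c vc]] := sign_cases v.
    exact: subeigen_sign_parts vi vj vA.
  (* The modulus of a one-signed vector of sum 0 would have sum 0, but that sum is positive. *)
  have := subeigen_sum_gt0 (subeigen_norm A0 v0 vA).
  by under eq_bigr do rewrite vc; rewrite -mulr_sumr vs mulr0 ltxx.
move: r1 r2; rewrite -!eigenvalue_root_char.
move=> /eigenvalueP [u uA u0] /eigenvalueP [v vA v0].
have [[i [j [ui uj]]]|[c uc]] := sign_cases u.
  have [p [q [pP qP pq]]] := subeigen_sign_parts A0 ui uj uA.
  by exists p, q; split=> //; apply: subeigenW le21 _.
have [[i [j [vi vj]]]|[d vd]] := sign_cases v.
  exact: subeigen_sign_parts vi vj vA.
exists (fun i => `|u 0 i|), (fun i => `|v 0 i|); split=> [||i].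
- by apply: subeigenW le21 _; apply: subeigen_norm.
- exact: subeigen_norm.
(* [u] and [v] are orthogonal and each of constant sign, so the nonnegative products of their moduli
   sum to 0 and each of them vanishes. *)
have uv0 : \sum_i `|u 0 i| * `|v 0 i| = 0.
  under eq_bigr do rewrite uc vd mulrACA.
  by rewrite -mulr_sumr (sym_eigvec_orthogonal As ne12) ?mulr0.
by apply: (psumr_eq0P _ uv0) => // k _; rewrite mulr_ge0.
Qed.

Theorem theorem18 (R : realType) (n : nat) (hn : (2 <= n)%N)
    (G : looped_graph n) :
  lambda 1 (adjmx R G) + lambda 2 (adjmx R (graph_compl G))
    <= 8%:R / 7%:R * n%:R.
Proof.
have adj0 (H : looped_graph n) i j : 0 <= adjmx R H i j by rewrite mxE ler0n.
have [p [q [pP qP pq]]] := disjoint_subeigen hn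
  (adjmx_sym R (graph_compl G)) (adj0 (graph_compl G)).
have [r1 _ _ _] := lambda_sorted (adjmx_sym R G) hn.
move: r1; rewrite -eigenvalue_root_char => /eigenvalueP [v vA v0].
have fP := subeigen_norm (adj0 G) v0 vA.
exact: (subeigen_sum_le (adj0 _) (adj0 _) (adjmx_sym _ _)
  (adjmx_compl _ _) fP pP qP pq).
Qed.
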